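(* Assume $V$ (with its fixed numbering) satisfies conditions (BF), (Cm), (Cn), (Cs). If a sequent $S$ is derivable in $\mathsf{BQC}$ and $\bar r=r_1,\dots,r_l$ is an admissible list of variables for $S$, then there exists a natural number $e$ such that $e\mathrel{\mathbf r^{V,\bar r}_f}S$ for every evaluation $f$ (i.e. for every $M\subseteq\mathbb N$ and every $M$-evaluation $f$).
   Context: $V$-functions. Let $\mathsf c:\mathbb N^2\to\mathbb N$ be a bijection and $\mathsf p_1,\mathsf p_2:\mathbb N\to\mathbb N$ the functions with $\mathsf p_1(\mathsf c(a,b))=a$, $\mathsf p_2(\mathsf c(a,b))=b$ for all $a,b$. For $n\ge1$, $1\le i\le n$, let $I^i_n(a_1,\dots,a_n)=a_i$. Let $V$ be a countable set of partial functions with arguments and values in $\mathbb N$ (of arities $n\ge0$), and $V_n$ the set of its $n$-ary members. For each $n\ge0$ a numbering is fixed: a set $\mathsf I_n\subseteq\mathbb N$ and a map $e\mapsto\varphi^{V}_e$ from $\mathsf I_n$ onto $V_n$. For expressions $t_1,t_2$ built from numbers, variables and functions in $V$, $t_1\simeq t_2$ means: for every assignment of numbers to the variables, either both are undefined, or both are defined and equal. Conditions: (BF) $I^i_n$ ($n\ge1$, $1\le i\le n$), $\mathsf c,\mathsf p_1,\mathsf p_2$ belong to $V$. (Cm) For all $n,m_1,\dots,m_n$, with $m=\max_i m_i$, there is an $(n+1)$-ary $s\in V$ such that for all $e\in\mathsf I_n$, $e_i\in\mathsf I_{m_i}$: $s(e,e_1,\dots,e_n)\in\mathsf I_m$ and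 $\varphi^V_{s(e,e_1,\dots,e_n)}(x_1,\dots,x_m)\simeq\varphi^V_e(\varphi^V_{e_1}(x_1,\dots,x_{m_1}),\dots,\varphi^V_{e_n}(x_1,\dots,x_{m_n}))$. (Cn) There is $s\in V$ with $s(k)\in\mathsf I_0$ and $\varphi^V_{s(k)}\simeq k$ for all $k$. (Cs) For every $n$ there is $s\in V$ such that for all $e_1,e_2\in\mathsf I_{n+1}$: $s(e_1,e_2)\in\mathsf I_{n+1}$, and for all $d$, $\varphi^V_{s(e_1,e_2)}(x_1,\dots,x_n,d)\simeq\varphi^V_{e_1}(x_1,\dots,x_n,d)$ if $\mathsf p_1d=0$ and $\simeq\varphi^V_{e_2}(x_1,\dots,x_n,d)$ if $\mathsf p_1 d\neq0$. Language. $L_{\mathsf{BQC}}$ has countably many predicate symbols of each finite arity, variables, constants $\bot,\top$, connectives $\land,\lor$, and quantifier forms. For $M\subseteq\mathbb N$, $L^M_{\mathsf{BQC}}$ adds the elements of $M$ as individual constants; terms are constants and variables; atoms are $\bot,\top,P(t_1,\dots,t_n)$. Formulas: $A,B::=\text{atom}\mid A\land B\mid A\lor B\mid\forall\bar x(A\to B)\mid\exists y\,A$, where $\bar x$ is a possibly empty list of distinct variables; $A\to B$ abbreviates $\forall(A\to B)$ with empty list. An occurrence of $x$ is free if not in the scope of $\exists x$ or of $\forall\bar z$ with $x$ in $\bar z$. A sentence has no free variables. $[\bar t/\bar x]A$ denotes simultaneous substitution of $\bar t$ for the free occurrences of $\bar x$ after renaming bound variables to avoid capture. A sequent is $A\Rightarrow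 B$ with $A,B$ formulas of $L_{\mathsf{BQC}}$. $\mathsf{BQC}$ ($\bar x,\bar y$ lists of distinct variables with $|\bar x|=|\bar y|$). Axioms: A1 $A\Rightarrow A$; A2 $A\Rightarrow\top$; A3 $\bot\Rightarrow A$; A4 $A\land\exists x B\Rightarrow\exists x(A\land B)$, $x$ not free in $A$; A5 $A\land(B\lor C)\Rightarrow(A\land B)\lor(A\land C)$; A6 $\forall\bar x(A\to B)\land\forall\bar x(B\to C)\Rightarrow\forall\bar x(A\to C)$; A7 $\forall\bar x(A\to B)\land\forall\bar x(A\to C)\Rightarrow\forall\bar x(A\to B\land C)$; A8 $\forall\bar x(B\to A)\land\forall\bar x(C\to A)\Rightarrow\forall\bar x(B\lor C\to A)$; A9 $\forall\bar x(A\to B)\Rightarrow\forall\bar x([\bar y/\bar x]A\to[\bar y/\bar x]B)$; A10 $\forall\bar x(A\to B)\Rightarrow\forall\bar y(A\to B)$, no variable of $\bar y$ free in $\forall\bar x(A\to B)$; A11 $\forall\bar x,x(B\to A)\Rightarrow\forall\bar x(\exists xB\to A)$, $x$ not free in $A$. Rules: R1 from $A\Rightarrow B$, $B\Rightarrow C$ infer $A\Rightarrow C$; R2 from $A\Rightarrow B$, $A\Rightarrow C$ infer $A\Rightarrow B\land C$; R3 from $A\Rightarrow B\land C$ infer $A\Rightarrow B$ and $A\Rightarrow C$; R4 from $B\Rightarrow A$, $C\Rightarrow A$ infer $B\lor C\Rightarrow A$; R5 from $B\lor C\Rightarrow A$ infer $B\Rightarrow A$ and $C\Rightarrow A$; R6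 from $A\Rightarrow B$ infer $[\bar y/\bar x]A\Rightarrow[\bar y/\bar x]B$; R7 from $B\Rightarrow A$ infer $\exists xB\Rightarrow A$, $x$ not free in $A$; R8 from $\exists xB\Rightarrow A$ infer $B\Rightarrow A$, $x$ not free in $A$; R9 from $A\land B\Rightarrow C$ infer $A\Rightarrow\forall\bar x(B\to C)$, no variable of $\bar x$ free in $A$. Realizability. An $n$-ary generalized predicate on $M$ is a total map $M^n\to 2^{\mathbb N}$; an $M$-evaluation $f$ assigns to each $n$-ary predicate symbol $P$ an $n$-ary generalized predicate $P^f$ on $M$; an evaluation is an $M$-evaluation for some $M\subseteq\mathbb N$. For an $M$-sentence: no $e$ realizes $\bot$; every $e$ realizes $\top$; $e\mathrel{\mathbf r^V_f}P(a_1,\dots,a_n)$ iff $e\in P^f(a_1,\dots,a_n)$; $e\mathrel{\mathbf r^V_f}\Phi\land\Psi$ iff $\mathsf p_1e\mathrel{\mathbf r^V_f}\Phi$ and $\mathsf p_2e\mathrel{\mathbf r^V_f}\Psi$; $e\mathrel{\mathbf r^V_f}\Phi\lor\Psi$ iff ($\mathsf p_1e=0$ and $\mathsf p_2e\mathrel{\mathbf r^V_f}\Phi$) or ($\mathsf p_1e=1$ and $\mathsf p_2e\mathrel{\mathbf r^V_f}\Psi$); $e\mathrel{\mathbf r^V_f}\exists x\Phi(x)$ iff $\mathsf p_1e\in M$ and $\mathsf p_2e\mathrel{\mathbf r^V_f}\Phi(\mathsf p_1e)$; $e\mathrel{\mathbf r^V_f}\forall x_1,\dots,x_n(\Phi(x_1,\dots,x_n)\to\Psi(x_1,\dots,x_n))$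 iff $e\in\mathsf I_{n+1}$ and for all $s\in\mathbb N$, $a_1,\dots,a_n\in M$, if $s\mathrel{\mathbf r^V_f}\Phi(a_1,\dots,a_n)$ then $\varphi^V_e(a_1,\dots,a_n,s)$ is defined and realizes $\Psi(a_1,\dots,a_n)$. A list $\bar x$ of distinct variables is admissible for a sequent $A\Rightarrow B$ if all free variables of $A$ and $B$ are in $\bar x$; then $e\mathrel{\mathbf r^{V,\bar x}_f}A\Rightarrow B$ means $e\mathrel{\mathbf r^V_f}\forall\bar x(A\to B)$.
   Formalization: The admissible list is required to be nonempty (l ≥ 1); for l = 0 the claim fails, since A1 and R8 derive ⊤ ⇒ ∃x⊤, and a realizer for the empty list would have to name an element of every M ⊆ ℕ. *)

(* Defs.v *)
From mathcomp Require Import all_boot.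
From mathcomp Require Import boolp classical_sets.

Set Implicit Arguments.
Unset Strict Implicit.
Unset Printing Implicit Defensive.

Local Open Scope nat_scope.

(** * V-functions *)

Record pairing := Pairing {
  cpair : nat -> nat -> nat;
  p1 : nat -> nat;
  p2 : nat -> nat;
  cpair_bij : bijective (fun ab : nat * nat => cpair ab.1 ab.2);
  p1_cpair : forall a b, p1 (cpair a b) = a;
  p2_cpair : forall a b, p2 (cpair a b) = b
}.

(* [None] is "undefined", so that [t1 ~= t2] is equality in [option nat] for
   every assignment. *)
Definition pfun (n : nat) := n.-tuple nat -> option nat.

(* [Vidx n] is I_n, and [phi n e] is the n-ary function numbered by e; it is
   only meaningful for e in I_n.  Countability of V follows from [phi_onto]. *)
Record vsystem := VSystem {
  Vfun : forall n, set (pfun n);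
  Vidx : nat -> set nat;
  phi : forall n, nat -> pfun n;
  phi_onto : forall n, (@phi n @` Vidx n = @Vfun n)%classic
}.

(* g(v_1, ..., v_n), defined only when all the arguments v_i are. *)
Definition papply n (g : pfun n) (v : 'I_n -> option nat) : option nat :=
  if [forall i, isSome (v i)] then g [tuple odflt 0 (v i) | i < n] else None.

(* (x_1, ..., x_k) from (x_1, ..., x_m); only used for k <= m. *)
Definition prefix_tuple m k (x : m.-tuple nat) : k.-tuple nat :=
  [tuple nth 0 x j | j < k].

Definition condBF (P : pairing) (U : vsystem) : Prop :=
  [/\ forall n (i : 'I_n), Vfun U (fun x : n.-tuple nat => Some (tnth x i)),
      Vfun U (fun x : 2.-tuple nat =>
                Some (cpair P (tnth x ord0) (tnth x ord_max))),
      Vfun U (fun x : 1.-tuple nat => Some (p1 P (thead x)))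
    & Vfun U (fun x : 1.-tuple nat => Some (p2 P (thead x)))].

Definition condCm (U : vsystem) : Prop :=
  forall n (ms : 'I_n -> nat), let m := \max_(i < n) ms i in
  exists2 s : pfun n.+1, Vfun U s &
    forall (e : nat) (es : n.-tuple nat),
      Vidx U n e -> (forall i, Vidx U (ms i) (tnth es i)) ->
      exists k, [/\ s [tuple of e :: es] = Some k, Vidx U m k
        & forall x : m.-tuple nat,
            phi U k x =
            papply (@phi U n e)
              (fun i => phi U (tnth es i) (prefix_tuple (ms i) x))].

Definition condCn (U : vsystem) : Prop :=
  exists2 s : pfun 1, Vfun U s &
    forall k, exists j,
      [/\ s [tuple k] = Some j, Vidx U 0 j & phi U j [tuple] = Some k].

Definition condCs (P : pairing) (U : vsystem) : Prop :=
  forall n, exists2 s : pfun 2, Vfun U s &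
    forall e1 e2, Vidx U n.+1 e1 -> Vidx U n.+1 e2 ->
      exists k, [/\ s [tuple e1; e2] = Some k, Vidx U n.+1 k
        & forall (x : n.-tuple nat) (d : nat),
            let xd := [tuple of rcons x d] in
            phi U k xd = if p1 P d == 0 then phi U e1 xd else phi U e2 xd].

(** * The language *)

Record varlist := VarList { vars :> seq nat; vars_uniq : uniq vars }.

Inductive term (C : Type) : Type := Var (x : nat) | Cst (c : C).
Arguments Var {C} x.

(* [Pred k ts], with ts of size n, is the k-th n-ary predicate symbol applied
   to ts; [All xs A B] is "forall xs (A -> B)". *)
Inductive formula (C : Type) : Type :=
| Bot
| Top
| Pred n (k : nat) (ts : n.-tuple (term C))
| And (A B : formula C)
| Or (A B : formula C)
| All (xs : varlist) (A B : formula C)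
| Ex (x : nat) (A : formula C).
Arguments Bot {C}.
Arguments Top {C}.

(* L_BQC has no individual constants; L_BQC^M is [formula M]. *)
Notation bqc_formula := (formula void).

Definition tfv C (t : term C) : seq nat := if t is Var x then [:: x] else [::].

Fixpoint fv C (A : formula C) : seq nat :=
  match A with
  | Bot | Top => [::]
  | Pred _ _ ts => flatten [seq tfv t | t <- ts]
  | And A B | Or A B => fv A ++ fv B
  | All xs A B => [seq x <- fv A ++ fv B | x \notin vars xs]
  | Ex x A => [seq y <- fv A | y != x]
  end.

Definition tmap C D (h : C -> D) (t : term C) : term D :=
  match t with Var x => Var x | Cst c => Cst (h c) end.

Fixpoint fmap C D (h : C -> D) (A : formula C) : formula D :=
  match A with
  | Bot => Bot
  | Top => Top
  | Pred _ k ts => Pred k (map_tuple (tmap h) ts)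
  | And A B => And (fmap h A) (fmap h B)
  | Or A B => Or (fmap h A) (fmap h B)
  | All xs A B => All xs (fmap h A) (fmap h B)
  | Ex x A => Ex x (fmap h A)
  end.

Definition embed (M : Type) : bqc_formula -> formula M := fmap (of_void M).

(* xs_i is mapped to ys_i, any other x to r x; xs and ys have the same size,
   so that [index x xs] overflows ys exactly when x is not in xs. *)
Definition upd T (r : nat -> T) (xs : seq nat) (ys : seq T) : nat -> T :=
  fun x => nth (r x) ys (index x xs).

Definition tsubst C (sg : nat -> term C) (t : term C) : term C :=
  if t is Var x then sg x else t.

(* [subst_to sg A A']: A' results from A by renaming bound variables so as to
   avoid capture and simultaneously replacing every free x by sg x.  This is a
   relation because the new bound variables may be chosen arbitrarily, as long
   as nothing is captured. *)
Inductive subst_to C : (nat -> term C) -> formula C -> formula C -> Prop :=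
| subst_Bot sg : subst_to sg Bot Bot
| subst_Top sg : subst_to sg Top Top
| subst_Pred sg n k (ts : n.-tuple (term C)) :
    subst_to sg (Pred k ts) (Pred k (map_tuple (tsubst sg) ts))
| subst_And sg A B A' B' :
    subst_to sg A A' -> subst_to sg B B' ->
    subst_to sg (And A B) (And A' B')
| subst_Or sg A B A' B' :
    subst_to sg A A' -> subst_to sg B B' ->
    subst_to sg (Or A B) (Or A' B')
| subst_All sg (xs zs : varlist) A B A' B' :
    size zs = size xs ->
    (forall v z, v \in fv (All xs A B) -> z \in vars zs -> z \notin tfv (sg v)) ->
    subst_to (upd sg xs [seq Var z | z <- zs]) A A' ->
    subst_to (upd sg xs [seq Var z | z <- zs]) B B' ->
    subst_to sg (All xs A B) (All zs A' B')
| subst_Ex sg x z A A' :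
    (forall v, v \in fv (Ex x A) -> z \notin tfv (sg v)) ->
    subst_to (upd sg [:: x] [:: Var z]) A A' ->
    subst_to sg (Ex x A) (Ex z A').

(* A' is [ys/xs]A. *)
Definition var_subst (ys xs : seq nat) (A A' : bqc_formula) : Prop :=
  subst_to (upd Var xs [seq Var y | y <- ys]) A A'.

(** * The calculus BQC *)

Record sequent := Sequent { ante : bqc_formula; succ : bqc_formula }.

Notation "A =>> B" := (Sequent A B) (at level 70, no associativity).

Inductive derivable : sequent -> Prop :=
| bqc_A1 A : derivable (A =>> A)
| bqc_A2 A : derivable (A =>> Top)
| bqc_A3 A : derivable (Bot =>> A)
| bqc_A4 x A B : x \notin fv A ->
    derivable (And A (Ex x B) =>> Ex x (And A B))
| bqc_A5 A B C :
    derivable (And A (Or B C) =>> Or (And A B) (And A C))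
| bqc_A6 xs A B C :
    derivable (And (All xs A B) (All xs B C) =>> All xs A C)
| bqc_A7 xs A B C :
    derivable (And (All xs A B) (All xs A C) =>> All xs A (And B C))
| bqc_A8 xs A B C :
    derivable (And (All xs B A) (All xs C A) =>> All xs (Or B C) A)
| bqc_A9 (xs ys : varlist) A B A' B' : size ys = size xs ->
    var_subst ys xs A A' -> var_subst ys xs B B' ->
    derivable (All xs A B =>> All xs A' B')
| bqc_A10 (xs ys : varlist) A B : size ys = size xs ->
    (forall y, y \in vars ys -> y \notin fv (All xs A B)) ->
    derivable (All xs A B =>> All ys A B)
| bqc_A11 (xs xsx : varlist) x A B : vars xsx = rcons xs x ->
    x \notin fv A ->
    derivable (All xsx B A =>> All xs (Ex x B) A)
| bqc_R1 A B C :
    derivable (A =>> B) -> derivable (B =>> C) -> derivable (A =>> C)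
| bqc_R2 A B C :
    derivable (A =>> B) -> derivable (A =>> C) -> derivable (A =>> And B C)
| bqc_R3l A B C : derivable (A =>> And B C) -> derivable (A =>> B)
| bqc_R3r A B C : derivable (A =>> And B C) -> derivable (A =>> C)
| bqc_R4 A B C :
    derivable (B =>> A) -> derivable (C =>> A) -> derivable (Or B C =>> A)
| bqc_R5l A B C : derivable (Or B C =>> A) -> derivable (B =>> A)
| bqc_R5r A B C : derivable (Or B C =>> A) -> derivable (C =>> A)
| bqc_R6 (xs ys : varlist) A B A' B' : size ys = size xs ->
    var_subst ys xs A A' -> var_subst ys xs B B' ->
    derivable (A =>> B) -> derivable (A' =>> B')
| bqc_R7 x A B : x \notin fv A ->
    derivable (B =>> A) -> derivable (Ex x B =>> A)
| bqc_R8 x A B : x \notin fv A ->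
    derivable (Ex x B =>> A) -> derivable (B =>> A)
| bqc_R9 (xs : varlist) A B C :
    (forall x, x \in vars xs -> x \notin fv A) ->
    derivable (And A B =>> C) -> derivable (A =>> All xs B C).

(** * Realizability *)

Definition evaluation (M : set nat) :=
  forall n, nat -> n.-tuple M -> set nat.

Definition tval T (r : nat -> option T) (t : term T) : option T :=
  match t with Var x => r x | Cst c => Some c end.

(* [realizes P U f r A e]: e realizes the M-sentence obtained from A by
   replacing each free variable x with r x = Some a by the constant a (see
   [realizes_subst] below).  If [r] misses a free variable, the result is not a
   sentence and the value is irrelevant. *)
Fixpoint realizes (P : pairing) (U : vsystem) (M : set nat) (f : evaluation M)
    (r : nat -> option M) (A : formula M) (e : nat) {struct A} : Prop :=
  match A with
  | Bot => False
  | Top => True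
  | Pred n k ts =>
      exists a : n.-tuple M,
        (forall i, tval r (tnth ts i) = Some (tnth a i)) /\ f n k a e
  | And A B => realizes P U f r A (p1 P e) /\ realizes P U f r B (p2 P e)
  | Or A B =>
      (p1 P e = 0 /\ realizes P U f r A (p2 P e)) \/
      (p1 P e = 1 /\ realizes P U f r B (p2 P e))
  | All xs A B =>
      Vidx U (size xs).+1 e /\
      forall (s : nat) (a : (size xs).-tuple M),
        let r' := upd r xs [seq Some c | c <- a] in
        realizes P U f r' A s ->
        exists2 b,
          phi U e [tuple of rcons (map_tuple val a) s] = Some b &
          realizes P U f r' B b
  | Ex x A =>
      exists2 a : M, val a = p1 P e &
        realizes P U f (upd r [:: x] [:: Some a]) A (p2 P e)
  end.

Definition realizes_sentence (P : pairing) (U : vsystem) (M : set nat)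
    (f : evaluation M) (A : formula M) (e : nat) : Prop :=
  realizes P U f (fun=> None) A e.

Definition admissible (xs : varlist) (S : sequent) : Prop :=
  {subset fv (ante S) ++ fv (succ S) <= vars xs}.

Definition realizes_sequent (P : pairing) (U : vsystem) (M : set nat)
    (f : evaluation M) (xs : varlist) (S : sequent) (e : nat) : Prop :=
  realizes_sentence P U f (All xs (embed M (ante S)) (embed M (succ S))) e.

Lemma updE T (r r' : nat -> T) (xs : seq nat) (ys : seq T) x :
  size ys = size xs -> (x \notin xs -> r x = r' x) ->
  upd r xs ys x = upd r' xs ys x.
Proof.
rewrite /upd => eqs rE; have [xin|xnin] := boolP (x \in xs).
  by apply: set_nth_default; rewrite eqs index_mem.
by rewrite !nth_default ?eqs ?memNindex // rE.
Qed.

Lemma realizes_ext P U (M : set nat) (f : evaluation M) A r r' e :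
  {in fv A, r =1 r'} -> realizes P U f r A e <-> realizes P U f r' A e.
Proof.
elim: A r r' e => [||n k ts|A IHA B IHB|A IHA B IHB|xs A IHA B IHB|x A IHA]
  r r' e //= rE.
- have tE i : tval r (tnth ts i) = tval r' (tnth ts i).
    have: {subset tfv (tnth ts i) <= flatten [seq tfv t | t <- ts]}.
      move=> x xin; apply/flattenP; exists (tfv (tnth ts i)) => //.
      by rewrite -tnth_map mem_tnth.
    by case: (tnth ts i) => //= x sub; apply/rE/sub; rewrite inE.
  by split=> -[a [ta fa]]; exists a; split=> // i; rewrite -ta tE.
- have [EA EB] : {in fv A, r =1 r'} /\ {in fv B, r =1 r'}.
    by split=> x xin; apply: rE; rewrite mem_cat xin ?orbT.
  by rewrite (IHA _ _ _ EA) (IHB _ _ _ EB).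
- have [EA EB] : {in fv A, r =1 r'} /\ {in fv B, r =1 r'}.
    by split=> x xin; apply: rE; rewrite mem_cat xin ?orbT.
  by rewrite (IHA _ _ _ EA) (IHB _ _ _ EB).
- have E (a : (size xs).-tuple M) :
     {in fv A, upd r xs [seq Some c | c <- a] =1
               upd r' xs [seq Some c | c <- a]} /\
     {in fv B, upd r xs [seq Some c | c <- a] =1
               upd r' xs [seq Some c | c <- a]}.
    by split=> x xin; apply: updE; rewrite ?size_map ?size_tuple // => xnin;
      apply: rE => /=; rewrite mem_filter mem_cat xnin xin ?orbT.
  split=> -[Ie H]; split=> // s a.
    by rewrite -(IHA _ _ _ (E a).1) => /H[b eb Bb]; exists b => //;
      rewrite -(IHB _ _ _ (E a).2).
  by rewrite (IHA _ _ _ (E a).1) => /H[b eb Bb]; exists b => //;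
    rewrite (IHB _ _ _ (E a).2).
- have EA (a : M) : {in fv A, upd r [:: x] [:: Some a] =1
                              upd r' [:: x] [:: Some a]}.
    move=> y yin; apply: updE => //; rewrite inE => yx.
    by apply: rE; rewrite mem_filter yx.
  by split=> -[a ae H]; exists a => //; move: H; rewrite (IHA _ _ _ (EA a)).
Qed.

Lemma upd_subst T (r : nat -> option T) (sg : nat -> term T)
    (xs zs : seq nat) (a : seq T) v :
  uniq zs -> size zs = size xs -> size a = size xs ->
  (v \notin xs -> forall z, z \in zs -> z \notin tfv (sg v)) ->
  tval (upd r zs [seq Some c | c <- a]) (upd sg xs [seq Var z | z <- zs] v) =
  upd (fun x => tval r (sg x)) xs [seq Some c | c <- a] v.
Proof.
move=> Uzs szs sa fresh; rewrite /upd.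
have [vin|vnin] := boolP (v \in xs).
  have iz : index v xs < size zs by rewrite szs index_mem.
  rewrite (nth_map 0) //= index_uniq //.
  by apply: set_nth_default; rewrite size_map sa index_mem.
rewrite !nth_default ?size_map ?szs ?sa ?memNindex //.
case: (sg v) (fresh vnin) => //= y fr.
rewrite nth_default // size_map sa -szs leqNgt index_mem.
by apply/negP => /fr; rewrite inE eqxx.
Qed.

Lemma realizes_subst P U (M : set nat) (f : evaluation M) sg A A' r e :
  subst_to sg A A' ->
  realizes P U f r A' e <-> realizes P U f (fun x => tval r (sg x)) A e.
Proof.
move=> sA; elim: sA r e => {sg A A'} //=
  [sg n k ts|sg A B A' B' _ IHA _ IHB|sg A B A' B' _ IHA _ IHB
  |sg xs zs A B A' B' szs fresh _ IHA _ IHB|sg x z A A' fresh _ IHA] r e.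
- suff tE t : tval r (tsubst sg t) = tval (fun x => tval r (sg x)) t.
    by split=> -[a [ta fa]]; exists a; split=> // i; have := ta i;
      rewrite ?tnth_map tE.
  by case: t.
- by rewrite IHA IHB.
- by rewrite IHA IHB.
- rewrite szs.
  have E (a : (size xs).-tuple M) : {in fv A ++ fv B,
      (fun v => tval (upd r zs [seq Some c | c <- a])
                     (upd sg xs [seq Var z | z <- zs] v)) =1
      upd (fun x => tval r (sg x)) xs [seq Some c | c <- a]}.
    move=> v vin; apply: upd_subst; rewrite ?size_tuple ?vars_uniq //.
    by move=> vn z zin; apply: fresh => //=; rewrite mem_filter vn.
  have EA' (a : (size xs).-tuple M) e' : realizes P U f (upd r zs [seq Some c | c <- a]) A' e' <->
     realizes P U f (upd (fun x => tval r (sg x)) xs [seq Some c | c <- a])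
       A e'.
    rewrite IHA; apply: realizes_ext => v vin.
    by rewrite -(E a) // mem_cat vin.
  have EB' (a : (size xs).-tuple M) e' : realizes P U f (upd r zs [seq Some c | c <- a]) B' e' <->
     realizes P U f (upd (fun x => tval r (sg x)) xs [seq Some c | c <- a])
       B e'.
    rewrite IHB; apply: realizes_ext => v vin.
    by rewrite -(E a) // mem_cat vin orbT.
  by split=> -[Ie H]; split=> // s a; [rewrite -EA'|rewrite EA'] => /H[b eb];
    [rewrite EB'|rewrite -EB']; exists b.
- have E (a : M) e' : realizes P U f (upd r [:: z] [:: Some a]) A' e' <->
     realizes P U f (upd (fun y => tval r (sg y)) [:: x] [:: Some a]) A e'.
    rewrite IHA; apply: realizes_ext => v vin.
    apply: (@upd_subst _ r sg [:: x] [:: z] [:: a]) => //.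
    rewrite inE => vx y; rewrite inE => /eqP->.
    by apply: fresh => /=; rewrite mem_filter vx.
  by split=> -[a ae H]; exists a => //; apply/E.
Qed.

(* A single realizer cannot work for all M when the list of variables is empty:
   by bqc_A1 and bqc_R8, BQC derives the sequent below, and a realizer for the empty
   list would have to name an element of every nonempty M. *)
Lemma empty_list_no_uniform_realizer (P : pairing) (U : vsystem) :
  let S := Top =>> Ex 0 Top in
  let nil := VarList (isT : uniq [::]) in
  [/\ derivable S, admissible nil S
    & ~ exists e, forall (M : set nat) (f : evaluation M),
        (M !=set0)%classic -> realizes_sequent P U f nil S e].
Proof.
split=> //; first by apply: (@bqc_R8 0) => //; apply: bqc_A1.
case=> e H; pose f (M : set nat) : evaluation M := fun n k a => setT.
have [_ H0] := H _ (f [set 0]%classic) (ex_intro _ 0 erefl).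
have [_ H1] := H _ (f [set 1]%classic) (ex_intro _ 1 erefl).
have [b + [x xb _]] := H0 0 [tuple] I.
have [b' + [y yb _]] := H1 0 [tuple] I.
rewrite (_ : [tuple of rcons (map_tuple val [tuple]) 0] = [tuple 0]); last first.
  exact: val_inj.
rewrite (_ : [tuple of rcons (map_tuple val [tuple]) 0] = [tuple 0]); last first.
  exact: val_inj.
move=> -> [bb']; subst b'.
have x0 : val x = 0 := set_valP x; have y1 : val y = 1 := set_valP y.
by have := x0; rewrite xb -yb y1.
Qed.

(* Main.v *)
(* Realizers are built uniformly in a total assignment rho of elements of M to
   all variables.  [valid A B] says that some function of V, applied to the
   values of finitely many variables under rho and to a realizer of A, gives a
   realizer of B, for all M, f and rho.  Since rho is total, the variables lost
   in a cut or in R8 cost nothing, and validity is preserved by every rule of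
   BQC.  A nonempty list r of variables is only needed at the end, to extend an
   assignment on r to a total one by repeating its first value.
   V has no explicit s-m-n function: parameters are passed by composing, through
   Cm, with the constants given by Cn. *)

Require Import Defs.
From mathcomp Require Import all_boot.
From mathcomp Require Import boolp classical_sets.

Set Implicit Arguments.
Unset Strict Implicit.
Unset Printing Implicit Defensive.

Section Families.

Variables (P : pairing) (U : vsystem).
Hypotheses (hBF : condBF P U) (hCm : condCm U) (hCn : condCn U)
  (hCs : condCs P U).

(** * Indices acting on lists, and their composition through (Cm) *)

Definition ev (e : nat) (s : seq nat) : option nat :=
  @phi U (size s) e (in_tuple s).

(** With arguments in a plain list, lengths become side conditions, so arities that are only
    provably equal require no transport. *)
Lemma phi_ev n e (t : n.-tuple nat) : phi U e t = ev e t.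
Proof.
case: t => s sz; have E := eqP sz; subst n.
by congr phi; apply: val_inj.
Qed.

Lemma Vfun_index n (g : pfun n) : Vfun U g ->
  exists2 e, Vidx U n e & forall x : n.-tuple nat, ev e x = g x.
Proof.
by rewrite -phi_onto => -[e Ie <-]; exists e => // x; rewrite phi_ev.
Qed.

(** The list form of (Cm): the i-th inner function reads a prefix of [x], and the equation is
    restricted to points where all inner values are defined, which removes [papply]. *)
Lemma Cm_seq (ms : seq nat) : let n := size ms in let m := \max_(i <- ms) i in
  exists2 s, Vidx U n.+1 s &
  forall e es, Vidx U n e -> size es = n ->
    (forall i, i < n -> Vidx U (nth 0 ms i) (nth 0 es i)) ->
    exists k, [/\ ev s (e :: es) = Some k, Vidx U m k &
      forall x vs, size x = m -> size vs = n ->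
        (forall i, i < n ->
           ev (nth 0 es i) (take (nth 0 ms i) x) = Some (nth 0 vs i)) ->
        ev k x = ev e vs].
Proof.
move=> n m.
have mE : m = \max_(i < n) nth 0 ms i by rewrite /m (big_nth 0) big_mkord.
have [g /Vfun_index[s Is sE] gE] := hCm (fun i : 'I_n => nth 0 ms i).
exists s => // e es Ie /eqP ses Ies; pose es' := Tuple ses.
have tE i : tnth es' i = nth 0 es i by rewrite (tnth_nth 0).
have [|k [ks Ik kE]] := gE e es' Ie.
  by move=> i; rewrite tE; apply: Ies.
rewrite -mE in Ik kE.
exists k; split=> //.
  by rewrite -ks -sE.
move=> x vs /eqP sx /eqP svs vsE.
have := kE (Tuple sx); rewrite phi_ev /= => ->.
have vE (i : 'I_n) :
    phi U (tnth es' i) (prefix_tuple (nth 0 ms i) (Tuple sx)) = Some (nth 0 vs i).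
  have lei : nth 0 ms i <= m by rewrite mE; apply: (leq_bigmax i).
  rewrite phi_ev tE -(vsE i) //; congr ev.
  apply: (@eq_from_nth _ 0) => [|j].
    by rewrite size_tuple size_takel // (eqP sx).
  rewrite size_tuple => lj.
  by rewrite nth_take // (nth_map (Ordinal lj)) ?size_enum_ord //= nth_enum_ord.
rewrite /papply ifT; last by apply/forallP => i; rewrite vE.
rewrite phi_ev; congr ev.
apply: (@eq_from_nth _ 0) => [|j]; rewrite size_tuple ?(eqP svs) // => lj.
rewrite (nth_map (Ordinal lj)) ?size_enum_ord //= (nth_ord_enum _ (Ordinal lj)).
by rewrite vE.
Qed.

Lemma bigmax_nseq k n : 0 < k -> \max_(i <- nseq k n) i = n.
Proof.
case: k => // k _; elim: k => [|k IH]; first by rewrite big_seq1.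
by rewrite /= big_cons IH maxnn.
Qed.

(** When all inner arities equal [n], each prefix is the whole of [x]; [0 < k] makes the maximum of
    the arities [n] rather than the empty maximum 0. *)
Lemma Cm_uniform k n : 0 < k -> exists2 s, Vidx U k.+1 s &
  forall e es, Vidx U k e -> size es = k ->
    (forall i, i < k -> Vidx U n (nth 0 es i)) ->
    exists j, [/\ ev s (e :: es) = Some j, Vidx U n j &
      forall x vs, size x = n -> size vs = k ->
        (forall i, i < k -> ev (nth 0 es i) x = Some (nth 0 vs i)) ->
        ev j x = ev e vs].
Proof.
move=> k0; have := Cm_seq (nseq k n).
rewrite /= bigmax_nseq // size_nseq => -[s Is sE]; exists s => // e es Ie ses Ies.
have [i ik|j [je Ij jE]] := sE e es Ie ses.
  by rewrite nth_nseq ik; apply: Ies.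
exists j; split=> // x vs sx svs vsE; apply: jE => // i ik.
by rewrite nth_nseq ik -sx take_size vsE.
Qed.

Lemma comp_index k n e es : 0 < k -> Vidx U k e -> size es = k ->
  (forall i, i < k -> Vidx U n (nth 0 es i)) ->
  exists2 j, Vidx U n j &
    forall x vs, size x = n -> size vs = k ->
      (forall i, i < k -> ev (nth 0 es i) x = Some (nth 0 vs i)) ->
      ev j x = ev e vs.
Proof.
move=> k0 Ie ses Ies; have [s _ sE] := Cm_uniform n k0.
by have [j [_ Ij jE]] := sE e es Ie ses Ies; exists j.
Qed.

(** Collects the indices of the inner functions of a composition into one list; being finite, the
    choice goes by induction on [k]. *)
Lemma finite_choice (k : nat) (Q : nat -> nat -> Prop) :
  (forall i, i < k -> exists e, Q i e) ->
  exists2 es, size es = k & forall i, i < k -> Q i (nth 0 es i).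
Proof.
elim: k Q => [|k IH] Q H; first by exists [::].
have [e Qe] := H 0 isT; have [//|es ses esE] := IH (fun i => Q i.+1).
  by move=> i ik; apply: H.
by exists (e :: es) => [|[|i]] //=; [rewrite ses | apply: esE].
Qed.

(** * Total functions represented in V *)

Definition computable n (G : seq nat -> nat) : Prop :=
  exists2 e, Vidx U n e & forall x, size x = n -> ev e x = Some (G x).

Lemma proj_computable n i : i < n -> computable n (fun x => nth 0 x i).
Proof.
move=> lti; have [H _ _ _] := hBF.
have [e Ie eE] := Vfun_index (H n (Ordinal lti)).
exists e => // x /eqP sx; rewrite (eE (Tuple sx)).
by rewrite (tnth_nth 0).
Qed.

Lemma comp_computable k n G (H : nat -> seq nat -> nat) : 0 < k ->
  computable k G -> (forall i, i < k -> computable n (H i)) ->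
  computable n (fun x => G (mkseq (H^~ x) k)).
Proof.
move=> k0 [e Ie eE] cH.
have [|es ses esE] := @finite_choice k (fun i e => Vidx U n e /\
    forall x, size x = n -> ev e x = Some (H i x)).
  by move=> i /cH[d Id dE]; exists d.
have [i /esE[]//|j Ij jE] := comp_index k0 Ie ses (n := n).
exists j => // x sx; rewrite (jE x (mkseq (H^~ x) k)) ?size_mkseq //.
  by rewrite eE ?size_mkseq.
by move=> i ik; rewrite nth_mkseq // (esE i ik).2.
Qed.

Lemma pair_computable :
  computable 2 (fun x => cpair P (nth 0 x 0) (nth 0 x 1)).
Proof.
have [_ /Vfun_index[e Ie eE] _ _] := hBF.
by exists e => // x /eqP sx; rewrite (eE (Tuple sx)) !(tnth_nth 0).
Qed.

Lemma p1_computable : computable 1 (fun x => p1 P (nth 0 x 0)).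
Proof.
have [_ _ /Vfun_index[e Ie eE] _] := hBF.
by exists e => // x /eqP sx; rewrite (eE (Tuple sx)) /thead (tnth_nth 0).
Qed.

Lemma p2_computable : computable 1 (fun x => p2 P (nth 0 x 0)).
Proof.
have [_ _ _ /Vfun_index[e Ie eE]] := hBF.
by exists e => // x /eqP sx; rewrite (eE (Tuple sx)) /thead (tnth_nth 0).
Qed.

Lemma computable_p1 n G : computable n G -> computable n (fun x => p1 P (G x)).
Proof.
move=> cG.
exact: (comp_computable (k := 1) (H := fun=> G) isT p1_computable (fun _ _ => cG)).
Qed.

Lemma computable_p2 n G : computable n G -> computable n (fun x => p2 P (G x)).
Proof.
move=> cG.
exact: (comp_computable (k := 1) (H := fun=> G) isT p2_computable (fun _ _ => cG)).
Qed.

(** * Functions of V whose values are indices *)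

(* [fam m n D Phi]: some m-ary function in V sends every x satisfying D to an
   index of an n-ary function whose graph includes [Phi x].  Only the inclusion
   matters, since realizability never uses that a realizer is undefined. *)
Definition fam m n (D : seq nat -> Prop) (Phi : seq nat -> seq nat -> nat -> Prop)
    : Prop :=
  exists2 e, Vidx U m e & forall x, size x = m -> D x ->
    exists k, [/\ ev e x = Some k, Vidx U n k &
      forall y v, size y = n -> Phi x y v -> ev k y = Some v].

Lemma fam_sub m n D (Phi Psi : seq nat -> seq nat -> nat -> Prop) :
  (forall x y v, size x = m -> D x -> size y = n -> Psi x y v -> Phi x y v) ->
  fam m n D Phi -> fam m n D Psi.
Proof.
move=> sub [e Ie eE]; exists e => // x sx Dx; have [k [ke Ik kE]] := eE x sx Dx.
by exists k; split=> // y v sy Pv; apply: kE => //; apply: sub Pv.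
Qed.

(** (Cn) yields only 0-ary constants. Composing the binary first projection with such a constant and
    an n-ary projection gives the same value at arity [n], the maximum of 0 and [n]. Since [s], [p],
    [q] are fixed before [j], the new index depends on [j] through a function of V. *)
Lemma const_lift n : 0 < n -> exists2 s, Vidx U 3 s &
  exists p q, [/\ Vidx U 2 p, Vidx U n q &
    forall j c, Vidx U 0 j -> ev j [::] = Some c ->
      exists k, [/\ ev s [:: p; j; q] = Some k, Vidx U n k &
        forall y, size y = n -> ev k y = Some c]].
Proof.
move=> n0; have := Cm_seq [:: 0; n].
rewrite /= !big_cons big_nil maxn0 max0n => -[s Is sE]; exists s => //.
have [p Ip pE] := @proj_computable 2 0 isT.
have [q Iq qE] := proj_computable n0.
exists p, q; split=> // j c Ij jc.
have [//|//||k [sk Ik kE]] := sE p [:: j; q]; first by move=> [|[|]].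
exists k; split=> // y sy.
rewrite (kE y [:: c; nth 0 y 0]) //; first by rewrite pE.
by move=> [|[|]] //= _; rewrite ?take0 // -sy take_size qE.
Qed.

Lemma const_computable n c : 0 < n -> computable n (fun=> c).
Proof.
move=> n0; have [s _ [p [q [_ _ H]]]] := const_lift n0.
have [g _ /(_ c)[j [_ Ij jc]]] := hCn; rewrite phi_ev in jc.
by have [k [_ Ik kE]] := H j c Ij jc; exists k.
Qed.

Lemma fam_const m n D e : 0 < m -> Vidx U n e ->
  fam m n D (fun _ y v => ev e y = Some v).
Proof.
move=> m0 Ie; have [d Id dE] := const_computable e m0.
by exists d => // x sx _; exists e; rewrite dE.
Qed.

Lemma fam_index m n (D : seq nat -> Prop) G : computable m G ->
  (forall x, D x -> Vidx U n (G x)) ->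
  fam m n D (fun x y v => ev (G x) y = Some v).
Proof.
move=> [d Id dE] DI; exists d => // x sx Dx.
by exists (G x); rewrite dE //; split=> //; apply: DI.
Qed.

(** The substitute for s-m-n: from [x] one computes an index of the 0-ary constant [G x] by (Cn),
    and then by [const_lift] an index of that constant at arity [n]. *)
Lemma fam_param m n D G : 0 < m -> 0 < n -> computable m G ->
  fam m n D (fun x _ v => v = G x).
Proof.
move=> m0 n0 [g Ig gE].
have [s Is [p [q [Ip Iq sE]]]] := const_lift n0.
have [t /Vfun_index[t' It tE] H] := hCn.
have [p' Ip' pE] := const_computable p m0.
have [q' Iq' qE] := const_computable q m0.
have [|r Ir rE] := @comp_index 1 m t' [:: g] isT It erefl; first by case.
have [|j Ij jE] := @comp_index 3 m s [:: p'; r; q'] isT Is erefl.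
  by case=> [|[|[|]]].
exists j => // x sx _; have [c [tc Ic cE]] := H (G x).
rewrite phi_ev in cE.
have [k [sk Ik kE]] := sE c (G x) Ic cE.
exists k; split=> // [|y v sy ->]; last exact: kE.
rewrite (jE x [:: p; c; q]) // => -[|[|[|]]] //= _; rewrite ?pE ?qE //.
rewrite (rE x [:: G x]) // => [|[]//= _]; last by rewrite gE.
by rewrite -tc -tE.
Qed.

Lemma fam_fun m n D G : 0 < m -> computable n G ->
  fam m n D (fun _ y v => v = G y).
Proof.
move=> m0 [g Ig gE]; apply: fam_sub (fam_const D m0 Ig) => x y v _ _ sy ->.
exact: gE.
Qed.

(** Composition on two levels: (Cm) supplies a function [s] of V that composes indices, and
    composing [s] itself with the functions producing these indices gives the new index as a
    function of [x]. *)
Lemma fam_comp m k n D Psi (Phi : nat -> seq nat -> seq nat -> nat -> Prop) :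
  0 < k -> fam m k D Psi -> (forall i, i < k -> fam m n D (Phi i)) ->
  fam m n D (fun x y v => exists2 vs, size vs = k /\
    (forall i, i < k -> Phi i x y (nth 0 vs i)) & Psi x vs v).
Proof.
move=> k0 [e Ie eE] F; have [|es ses esE] := @finite_choice k (fun i d =>
    Vidx U m d /\ forall x, size x = m -> D x ->
      exists l, [/\ ev d x = Some l, Vidx U n l &
        forall y v, size y = n -> Phi i x y v -> ev l y = Some v]).
  by move=> i /F[d Id dE]; exists d.
have [s Is sE] := Cm_uniform n k0.
have [|[|i] //= /esE[]//|j Ij jE] := @comp_index k.+1 m s (e :: es) isT Is.
  by rewrite /= ses.
exists j => // x sx Dx; have [d [ed Id dE]] := eE x sx Dx.
have [|ks sks ksE] := @finite_choice k (fun i l =>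
    [/\ ev (nth 0 es i) x = Some l, Vidx U n l &
    forall y v, size y = n -> Phi i x y v -> ev l y = Some v]).
  by move=> i /esE[_ H]; have := H x sx Dx.
have [|l [sl Il lE]] := sE d ks Id sks; first by move=> i /ksE[].
exists l; split=> //.
  rewrite (jE x (d :: ks)) //= ?sks // => -[|i] //= ik.
  by have [] := ksE i ik.
move=> y v sy [vs [svs vsE] Pv]; rewrite (lE y vs) //; first exact: dE.
by move=> i ik; have [_ _ H] := ksE i ik; apply/H/vsE.
Qed.

(** (Cs) branches on [p1] of the last argument, which is where the realizer of a disjunction will
    stand. *)
Lemma fam_cases m n D (Phi Psi : seq nat -> seq nat -> nat -> Prop) :
  fam m n.+1 D Phi -> fam m n.+1 D Psi ->
  fam m n.+1 D (fun x y v =>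
    if p1 P (nth 0 y n) == 0 then Phi x y v else Psi x y v).
Proof.
move=> [e1 I1 e1E] [e2 I2 e2E].
have [g /Vfun_index[s Is sE] gE] := hCs n.
have [|j Ij jE] := @comp_index 2 m s [:: e1; e2] isT Is erefl.
  by case=> [|[|]].
exists j => // x sx Dx.
have [k1 [ek1 Ik1 k1E]] := e1E x sx Dx.
have [k2 [ek2 Ik2 k2E]] := e2E x sx Dx.
have [k [gk Ik kE]] := gE k1 k2 Ik1 Ik2.
exists k; split=> //.
  rewrite (jE x [:: k1; k2]) => [|||[|[|]]] //.
  by rewrite -gk -sE.
move=> y v sy H; case/lastP: y sy H => // y d; rewrite size_rcons => -[/eqP sy].
have := kE (Tuple sy) d; rewrite /= !phi_ev /= => ->.
rewrite nth_rcons (eqP sy) ltnn eqxx.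
by case: ifP => _ ?; [apply: k1E|apply: k2E] => //; rewrite size_rcons (eqP sy).
Qed.

Lemma fam_p1 m n D Phi : 0 < m ->
  fam m n D Phi -> fam m n D (fun x y v => exists2 u, Phi x y u & v = p1 P u).
Proof.
move=> m0 F; apply: fam_sub (fam_comp (k := 1) isT (fam_fun D m0 p1_computable)
  (fun i _ => F)) => x y v _ _ _ [u Pu ->].
by exists [:: u] => //; split=> // -[].
Qed.

Lemma fam_p2 m n D Phi : 0 < m ->
  fam m n D Phi -> fam m n D (fun x y v => exists2 u, Phi x y u & v = p2 P u).
Proof.
move=> m0 F; apply: fam_sub (fam_comp (k := 1) isT (fam_fun D m0 p2_computable)
  (fun i _ => F)) => x y v _ _ _ [u Pu ->].
by exists [:: u] => //; split=> // -[].
Qed.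

Lemma fam_pair m n D Phi Psi : 0 < m -> fam m n D Phi -> fam m n D Psi ->
  fam m n D (fun x y v => exists a b, [/\ Phi x y a, Psi x y b & v = cpair P a b]).
Proof.
move=> m0 F G; apply: fam_sub (fam_comp (k := 2) isT (fam_fun D m0 pair_computable)
  (Phi := fun i => if i == 0 then Phi else Psi) _) => [x y v _ _ _|i _].
  by move=> [a [b [Pa Pb ->]]]; exists [:: a; b] => //; split=> // -[|[|]].
by case: eqP.
Qed.

Lemma computable_pair n G H : computable n G -> computable n H ->
  computable n (fun x => cpair P (G x) (H x)).
Proof.
move=> cG cH; apply: (comp_computable (k := 2) (H := fun i => if i == 0 then G else H) isT
  pair_computable) => i _.
by case: eqP.
Qed.

Lemma fam_proj m n D i : 0 < m -> i < n ->
  fam m n D (fun _ y v => v = nth 0 y i).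
Proof. by move=> m0 ni; apply/fam_fun/proj_computable. Qed.

(** The last argument is kept apart because a realizer of [All] takes the values of the bound
    variables first and a realizer of the antecedent last. *)
Lemma fam_app m k n D Psi (Phi : nat -> seq nat -> seq nat -> nat -> Prop) Phil :
  fam m k.+1 D Psi -> (forall i, i < k -> fam m n D (Phi i)) ->
  fam m n D Phil ->
  fam m n D (fun x y v => exists vs t, [/\ size vs = k,
    forall i, i < k -> Phi i x y (nth 0 vs i), Phil x y t &
    Psi x (rcons vs t) v]).
Proof.
move=> FPsi FPhi FPhil.
apply: fam_sub (fam_comp (k := k.+1)
  (Phi := fun i => if i < k then Phi i else Phil) isT FPsi _).
  move=> x y v _ _ _ [vs [t [svs vsE tE vE]]].
  exists (rcons vs t) => //; split; rewrite ?size_rcons ?svs // => i.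
  rewrite ltnS leq_eqVlt nth_rcons svs => /orP[/eqP->|ik]; first by rewrite ltnn eqxx.
  by rewrite ik; apply: vsE.
by move=> i _; case: ifP => //; apply: FPhi.
Qed.

Lemma fam_app_last m k D Psi Phi : 0 < m ->
  fam m k.+1 D Psi -> fam m k.+1 D Phi ->
  fam m k.+1 D (fun x y v => exists2 t, Phi x y t & Psi x (rcons (take k y) t) v).
Proof.
move=> m0 FPsi FPhi.
apply: fam_sub (fam_app (Phi := fun i _ y v => v = nth 0 y i) FPsi _ FPhi).
  move=> x y v _ _ sy [t tE vE]; exists (take k y), t; split=> //.
    by rewrite size_takel // sy.
  by move=> i ik; rewrite nth_take.
by move=> i ik; apply: fam_proj => //; apply: ltnW.
Qed.

(** Rebinding by a quantifier: the old values sit in the parameter [x], the new ones in the argument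
    [y]. *)
Lemma fam_upd N n D (zs : seq nat) j : size zs = n -> j < N ->
  fam N.+1 n.+1 D (fun x y v => v = upd (nth 0 x) zs (take n y) j).
Proof.
(* Whether variable [j] is rebound depends on [j] and [zs] alone, so the choice between a projection
   and a parameter is made outside V. *)
move=> szs jN; have [ji|ji] := ltnP (index j zs) n.
  apply: fam_sub (fam_proj (i := index j zs) _ (ltn0Sn N) (leqW ji)) => x y v _ _ sy ->.
  rewrite /upd nth_take //; apply: set_nth_default.
  by rewrite sy ltnW.
apply: fam_sub (fam_param _ (ltn0Sn N) (ltn0Sn n) (proj_computable (leqW jN))).
move=> x y v _ _ sy ->.
by rewrite /upd nth_default // size_takel // sy.
Qed.

(** * Realizability under total assignments *)

Definition rz (M : set nat) (f : evaluation M) (rho : nat -> M)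
    (A : bqc_formula) (e : nat) : Prop :=
  realizes P U f (fun x => Some (rho x)) (embed M A) e.

Lemma fv_fmap C D (h : C -> D) (A : formula C) : fv (fmap h A) = fv A.
Proof.
elim: A => //= [n k ts|A -> B ->|A -> B ->|xs A -> B ->|x A ->] //.
by rewrite -map_comp; congr flatten; apply: eq_map => -[].
Qed.

Lemma rz_ext (M : set nat) (f : evaluation M) rho rho' A e :
  {in fv A, rho =1 rho'} -> rz f rho A e <-> rz f rho' A e.
Proof.
by move=> E; apply: realizes_ext => x; rewrite fv_fmap => /E ->.
Qed.

Lemma map_upd T T' (h : T -> T') r xs ys x :
  h (upd r xs ys x) = upd (fun z => h (r z)) xs (map h ys) x.
Proof.
rewrite /upd; case: (ltnP (index x xs) (size ys)) => H.
  by rewrite (nth_map (r x)).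
by rewrite !nth_default ?size_map.
Qed.

(** An update of a total assignment is total, so [Some] moves outside [upd] and the options
    disappear from the clause. *)
Lemma rz_All (M : set nat) (f : evaluation M) rho (xs : varlist) A B e :
  rz f rho (All xs A B) e <-> Vidx U (size xs).+1 e /\
    forall s (a : seq M), size a = size xs -> rz f (upd rho xs a) A s ->
      exists2 b, ev e (rcons (map val a) s) = Some b & rz f (upd rho xs a) B b.
Proof.
have E (a : seq M) : upd (fun x => Some (rho x)) xs [seq Some c | c <- a] =
    (fun x => Some (upd rho xs a x)).
  by apply: funext => x; rewrite (map_upd Some).
split=> -[Ie H]; split=> // s a.
  move=> /eqP sa; have := H s (Tuple sa).
  by rewrite /= E phi_ev.
by rewrite /= E phi_ev; apply: H; rewrite size_tuple.
Qed.

Lemma rz_Ex (M : set nat) (f : evaluation M) rho x A e :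
  rz f rho (Ex x A) e <->
  exists2 a : M, val a = p1 P e & rz f (upd rho [:: x] [:: a]) A (p2 P e).
Proof.
have E (a : M) : upd (fun x => Some (rho x)) [:: x] [:: Some a] =
    (fun z => Some (upd rho [:: x] [:: a] z)).
  by apply: funext => z; rewrite (map_upd Some).
by split=> -[a aE]; rewrite /= ?E => H; exists a => //=; rewrite ?E.
Qed.

(** Substitution in BQC relates formulas without constants, while [realizes_subst] concerns
    M-formulas; the embedding leaves variables unchanged, hence causes no capture. *)
Lemma subst_to_fmap C D (h : C -> D) sg A A' : subst_to sg A A' ->
  subst_to (fun x => tmap h (sg x)) (fmap h A) (fmap h A').
Proof.
have tfvE (t : term C) : tfv (tmap h t) = tfv t by case: t.
elim=> {sg A A'} /= [sg|sg|sg n k ts|sg A B A' B' _ IHA _ IHB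
  |sg A B A' B' _ IHA _ IHB|sg xs zs A B A' B' szs fresh _ IHA _ IHB
  |sg x z A A' fresh _ IHA].
- exact: subst_Bot.
- exact: subst_Top.
- have -> : map_tuple (tmap h) (map_tuple (tsubst sg) ts) =
    map_tuple (tsubst (fun x => tmap h (sg x))) (map_tuple (tmap h) ts).
    by apply: val_inj; rewrite /= -!map_comp; apply: eq_map => -[].
  exact: subst_Pred.
- exact: subst_And.
- exact: subst_Or.
- have E : (fun x => tmap h (upd sg xs [seq Var z | z <- zs] x)) =
      upd (fun x => tmap h (sg x)) xs [seq Var z | z <- zs].
    by apply: funext => x; rewrite (map_upd (tmap h)) -map_comp.
  rewrite E in IHA IHB; apply: subst_All => // v z.
  by rewrite /= !fv_fmap tfvE; apply: fresh.
- have E : (fun y => tmap h (upd sg [:: x] [:: Var z] y)) =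
      upd (fun x => tmap h (sg x)) [:: x] [:: Var z].
    by apply: funext => y; rewrite (map_upd (tmap h)).
  rewrite E in IHA; apply: subst_Ex => // v.
  by rewrite /= !fv_fmap tfvE; apply: fresh.
Qed.

Lemma rz_subst (M : set nat) (f : evaluation M) rho ys xs A A' e :
  var_subst ys xs A A' ->
  rz f rho A' e <-> rz f (upd rho xs (map rho ys)) A e.
Proof.
move=> /(subst_to_fmap (of_void M)) /realizes_subst sE.
rewrite /rz /embed sE.
set r := (fun x : nat => Defs.tval _ _); set r' := (fun x : nat => Some _).
suff -> : r = r' by [].
apply: funext => x; rewrite /r /r' (map_upd (tmap (of_void M))).
rewrite (map_upd (Defs.tval (fun x => Some (rho x)))) (map_upd Some).
by rewrite -!map_comp.
Qed.

(** * Validity, and tools for establishing it *)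

(** Variables are numbers, so any finite set of them lies below some [N]. The index [e] is fixed
    before [M], [f] and [rho], which carries the uniformity of the theorem. *)
Definition valid_at N A B : Prop :=
  exists2 e, Vidx U N.+1 e & forall (M : set nat) (f : evaluation M) rho s,
    rz f rho A s ->
    exists2 b, ev e (rcons (mkseq (fun j => val (rho j)) N) s) = Some b &
      rz f rho B b.

Definition valid A B : Prop := exists N, valid_at N A B.

Lemma nth_args N (g : nat -> nat) s j : j < N ->
  nth 0 (rcons (mkseq g N) s) j = g j.
Proof. by move=> jN; rewrite nth_rcons size_mkseq jN nth_mkseq. Qed.

Lemma nth_last_args N (g : nat -> nat) s : nth 0 (rcons (mkseq g N) s) N = s.
Proof. by rewrite nth_rcons size_mkseq ltnn eqxx. Qed.

Lemma take_rcons n (c : seq nat) t : size c = n -> take n (rcons c t) = c.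
Proof. by move=> <-; rewrite -cats1 take_size_cat. Qed.

Lemma nth_size_rcons n (c : seq nat) t : size c = n -> nth 0 (rcons c t) n = t.
Proof. by move=> <-; rewrite nth_rcons ltnn eqxx. Qed.

(** Lets the [fam] combinators build a single function: the unary parameter is a dummy, set to 0. *)
Lemma valid_fun N (Phi : seq nat -> nat -> Prop) A B :
  fam 1 N.+1 (fun=> True) (fun=> Phi) ->
  (forall (M : set nat) (f : evaluation M) rho s, rz f rho A s ->
    exists2 b, Phi (rcons (mkseq (fun j => val (rho j)) N) s) b & rz f rho B b) ->
  valid A B.
Proof.
move=> [e Ie eE] H; exists N.
have [//|k [_ Ik kE]] := eE [:: 0] _ I.
exists k => // M f rho s /H[b Pb rb]; exists b => //; apply: kE => //.
by rewrite size_rcons size_mkseq.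
Qed.

(** The parameter consists of the assignment and the realizer of [A], and the index computed from it
    is itself the required realizer. [D] can record which parts of the parameter are indices. *)
Lemma valid_All N D Phi (xs : varlist) A B C :
  fam N.+1 (size xs).+1 D Phi ->
  (forall (M : set nat) (f : evaluation M) rho s,
    rz f rho A s -> D (rcons (mkseq (fun j => val (rho j)) N) s) /\
    forall t (c : seq M), size c = size xs -> rz f (upd rho xs c) B t ->
      exists2 b, Phi (rcons (mkseq (fun j => val (rho j)) N) s)
                     (rcons (map val c) t) b &
        rz f (upd rho xs c) C b) ->
  valid A (All xs B C).
Proof.
move=> [e Ie eE] H; exists N, e => // M f rho s /H[Dx {}H].
have [|k [ek Ik kE]] := eE _ _ Dx; first by rewrite size_rcons size_mkseq.
exists k => //; apply/rz_All; split=> // t c sc /(H _ _ sc)[b Pb rb].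
by exists b => //; apply: kE => //; rewrite size_rcons size_map sc.
Qed.

(** Surplus arguments are dropped by projections; this brings the two premises of a rule to a common
    [N]. *)
Lemma valid_at_le N N' A B : N <= N' -> valid_at N A B -> valid_at N' A B.
Proof.
move=> le [e Ie eE].
have [|d Id dE] := fam_app (n := N'.+1) (Phi := fun i _ y v => v = nth 0 y i)
  (fam_const (m := 1) (fun=> True) (ltn0Sn 0) Ie) _
  (fam_proj _ (ltn0Sn 0) (ltnSn N')).
  by move=> i iN; apply: fam_proj => //; apply: leq_trans iN (leqW le).
have [//|k [_ Ik kE]] := dE [:: 0] _ I.
exists k => // M f rho s /eE[b eb rb]; exists b => //.
apply: kE; first by rewrite size_rcons size_mkseq.
exists (mkseq (fun j => val (rho j)) N), s; split=> //.
- by rewrite size_mkseq.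
- by move=> i iN; rewrite nth_args ?nth_mkseq // (leq_trans iN).
- by rewrite nth_last_args.
Qed.

Lemma valid_at2 A B A' B' : valid A B -> valid A' B' ->
  exists N, valid_at N A B /\ valid_at N A' B'.
Proof.
move=> [N H] [N' H']; exists (maxn N N').
by split; [apply: valid_at_le H|apply: valid_at_le H']; rewrite ?leq_maxl ?leq_maxr.
Qed.

Lemma valid_computable N G A B : computable N.+1 G ->
  (forall (M : set nat) (f : evaluation M) rho s, rz f rho A s ->
    rz f rho B (G (rcons (mkseq (fun j => val (rho j)) N) s))) ->
  valid A B.
Proof.
move=> [e Ie eE] H; exists N, e => // M f rho s /H rb.
by eexists; last exact: rb; rewrite eE // size_rcons size_mkseq.
Qed.

(** * The axioms *)

Lemma arg_computable : computable 1 (fun x => nth 0 x 0).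
Proof. exact: proj_computable. Qed.

Lemma valid_A1 A : valid A A.
Proof. exact: (valid_computable (N := 0) arg_computable). Qed.

Lemma valid_A2 A : valid A Top.
Proof. exact: (valid_computable (N := 0) arg_computable). Qed.

Lemma valid_A3 A : valid Bot A.
Proof. exact: (valid_computable (N := 0) arg_computable). Qed.

(** One rearrangement serves A4 and A5: [p1 (p2 s)] is the existential witness in the former and the
    tag of the disjunct in the latter. *)
Lemma swap_computable : computable 1 (fun x => let s := nth 0 x 0 in
  cpair P (p1 P (p2 P s)) (cpair P (p1 P s) (p2 P (p2 P s)))).
Proof.
have c := arg_computable.
apply: computable_pair; first by do 2?[apply: computable_p1 | apply: computable_p2].
by apply: computable_pair; do 2?[apply: computable_p1 | apply: computable_p2].
Qed.

Lemma rz_fresh (M : set nat) (f : evaluation M) rho xs cs A e :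
  (forall x, x \in xs -> x \notin fv A) -> size cs = size xs ->
  rz f (upd rho xs cs) A e <-> rz f rho A e.
Proof.
move=> fresh sc; apply: rz_ext => x xA; rewrite /upd nth_default // sc.
by rewrite memNindex //; apply/negP => /fresh; rewrite xA.
Qed.

Lemma rz_fresh1 (M : set nat) (f : evaluation M) rho x c A e :
  x \notin fv A -> rz f (upd rho [:: x] [:: c]) A e <-> rz f rho A e.
Proof. by move=> xA; apply: rz_fresh => // y; rewrite inE => /eqP->. Qed.

Lemma valid_A4 x A B : x \notin fv A ->
  valid (And A (Ex x B)) (Ex x (And A B)).
Proof.
move=> xA; apply: (valid_computable (N := 0) swap_computable) => M f rho s.
move=> [sA /rz_Ex[c cE sB]]; apply/rz_Ex; exists c; first by rewrite /= p1_cpair.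
split; rewrite /= p2_cpair ?p1_cpair ?p2_cpair //.
exact/rz_fresh1.
Qed.

Lemma valid_A5 A B C : valid (And A (Or B C)) (Or (And A B) (And A C)).
Proof.
apply: (valid_computable (N := 0) swap_computable) => M f rho s /=.
rewrite /rz /= p1_cpair p2_cpair p1_cpair p2_cpair.
by move=> [sA [[s0 sB]|[s1 sC]]]; [left|right].
Qed.

(** Holds of realizers of a conjunction of two implications, the antecedents of A6, A7 and A8. *)
Definition arg_index n (x : seq nat) : Prop :=
  Vidx U n (p1 P (nth 0 x 0)) /\ Vidx U n (p2 P (nth 0 x 0)).

Lemma fam_arg_p1 n : fam 1 n (arg_index n)
  (fun x y v => ev (p1 P (nth 0 x 0)) y = Some v).
Proof. by apply: fam_index; [apply/computable_p1/arg_computable|move=> x []]. Qed.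

Lemma fam_arg_p2 n : fam 1 n (arg_index n)
  (fun x y v => ev (p2 P (nth 0 x 0)) y = Some v).
Proof. by apply: fam_index; [apply/computable_p2/arg_computable|move=> x []]. Qed.

Lemma valid_A6 xs A B C : valid (And (All xs A B) (All xs B C)) (All xs A C).
Proof.
apply: (valid_All (N := 0)
  (fam_app_last (ltn0Sn 0) (fam_arg_p2 _) (fam_arg_p1 _))).
move=> M f rho s /= [/rz_All[I1 H1] /rz_All[I2 H2]]; split=> // t c sc.
move=> /(H1 _ _ sc)[b eb /(H2 _ _ sc)[d ed rd]]; exists d => //.
by exists b => //; rewrite take_rcons ?size_map.
Qed.

Lemma valid_A7 xs A B C :
  valid (And (All xs A B) (All xs A C)) (All xs A (And B C)).
Proof.
apply: (valid_All (N := 0)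
  (fam_pair (ltn0Sn 0) (fam_arg_p1 _) (fam_arg_p2 _))).
move=> M f rho s /= [/rz_All[I1 H1] /rz_All[I2 H2]]; split=> // t c sc At.
have [b eb rb] := H1 _ _ sc At; have [d ed rd] := H2 _ _ sc At.
exists (cpair P b d); first by exists b, d.
by rewrite /rz /= p1_cpair p2_cpair.
Qed.

Lemma fam_last m n D : 0 < m -> fam m n.+1 D (fun _ y v => v = nth 0 y n).
Proof. by move=> m0; apply: fam_proj. Qed.

Lemma fam_p2_last m n D : 0 < m ->
  fam m n.+1 D (fun _ y v => v = p2 P (nth 0 y n)).
Proof. by move=> m0; apply/fam_fun/computable_p2/proj_computable. Qed.

Lemma valid_A8 xs A B C :
  valid (And (All xs B A) (All xs C A)) (All xs (Or B C) A).
Proof.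
apply: (valid_All (N := 0) (fam_cases
  (fam_app_last (ltn0Sn 0) (fam_arg_p1 _) (fam_p2_last _ _ (ltn0Sn 0)))
  (fam_app_last (ltn0Sn 0) (fam_arg_p2 _) (fam_p2_last _ _ (ltn0Sn 0))))).
move=> M f rho s /= [/rz_All[I1 H1] /rz_All[I2 H2]]; split=> // t c sc.
rewrite nth_size_rcons ?take_rcons ?size_map // => -[[-> Bt]|[-> Ct]] /=.
  by have [b eb rb] := H1 _ _ sc Bt; exists b => //; eexists.
by have [b eb rb] := H2 _ _ sc Ct; exists b => //; eexists.
Qed.

(** The common core of A9 and A10: the given realizer is called with the values that the variables
    in [w] have once [zs] is rebound. The two semantic hypotheses carry antecedents back and
    succedents forth. *)
Lemma valid_reindex (xs zs : varlist) w A B A' B' : size w = size xs ->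
  (forall (M : set nat) (f : evaluation M) rho cs e, size cs = size zs ->
    rz f (upd rho zs cs) A' e -> rz f (upd rho xs (map (upd rho zs cs) w)) A e) ->
  (forall (M : set nat) (f : evaluation M) rho cs e, size cs = size zs ->
    rz f (upd rho xs (map (upd rho zs cs) w)) B e -> rz f (upd rho zs cs) B' e) ->
  valid (All xs A B) (All zs A' B').
Proof.
(* [N] exceeds every variable in [w], so a value that [zs] does not rebind is found among the
   parameters. *)
move=> sw HA HB; have [N wN] : exists N, forall i, i < size xs -> nth 0 w i < N.
  exists (\max_(i <- w) i).+1 => i ix.
  by rewrite ltnS; apply: (leq_bigmax_seq (F := id)) => //; rewrite mem_nth // sw.
have F := fam_app
  (fam_index (D := fun x => Vidx U (size xs).+1 (nth 0 x N))
     (proj_computable (ltnSn N)) (fun x Dx => Dx))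
  (fun i ix => fam_upd _ (erefl (size zs)) (wN i ix)) (fam_last _ _ (ltn0Sn N)).
apply: (valid_All F) => M f rho s /rz_All[Is Hs].
rewrite nth_last_args; split=> // t c sc /(HA _ _ _ _ _ sc) At.
have [|b eb rb] := Hs _ _ _ At; first by rewrite size_map sw.
exists b; last exact: HB.
exists (map val (map (upd rho zs c) w)), t; split=> //.
- by rewrite !size_map.
- move=> i ix; rewrite take_rcons ?size_map // -map_comp (nth_map 0) ?sw //=.
  rewrite (map_upd val); apply: updE; rewrite ?size_map // => _.
  by rewrite nth_args // wN.
- by rewrite nth_size_rcons ?size_map.
Qed.

(** Here [w] is [ys]. By [rz_subst] the substitution becomes a second update of [xs], which
    overwrites the first. *)
Lemma valid_A9 (xs ys : varlist) A B A' B' : size ys = size xs ->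
  var_subst ys xs A A' -> var_subst ys xs B B' ->
  valid (All xs A B) (All xs A' B').
Proof.
move=> sy sA sB.
have E (M : set nat) (rho : nat -> M) cs : size cs = size xs ->
    upd (upd rho xs cs) xs (map (upd rho xs cs) ys) =
    upd rho xs (map (upd rho xs cs) ys).
  move=> sc; apply: funext => x; apply: updE; rewrite ?size_map ?sy // => xn.
  by rewrite /upd nth_default // sc memNindex.
apply: (valid_reindex sy) => M f rho cs e sc.
  by rewrite (rz_subst _ _ _ sA) E.
by rewrite (rz_subst _ _ _ sB) E.
Qed.

(** Here [w] is [xs]. A variable of [A] or [B] outside [xs] is not in [ys], so rebinding [ys] leaves
    it alone; one in [xs] is reassigned the value it has already. *)
Lemma valid_A10 (xs ys : varlist) A B : size ys = size xs ->
  (forall y, y \in vars ys -> y \notin fv (All xs A B)) ->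
  valid (All xs A B) (All ys A B).
Proof.
move=> sy fresh.
have E (M : set nat) (rho : nat -> M) cs : size cs = size ys ->
    {in fv A ++ fv B,
      upd rho ys cs =1 upd rho xs (map (upd rho ys cs) xs)}.
  move=> sc x xAB; rewrite {2}/upd.
  have [xin|xn] := boolP (x \in vars xs).
    by rewrite (nth_map 0) ?index_mem // nth_index.
  rewrite nth_default ?size_map ?memNindex // /upd nth_default //.
  rewrite sc memNindex //; apply/negP => /fresh /=.
  by rewrite mem_filter xn xAB.
apply: (valid_reindex (w := xs)) => // M f rho cs e sc.
  by apply/(iffLR (rz_ext _ _ _)) => x xA; apply: E => //; rewrite mem_cat xA.
apply/(iffRL (rz_ext _ _ _)) => x xB; apply: E => //.
by rewrite mem_cat xB orbT.
Qed.

(** [upd] follows the first occurrence in the list, so the last entry takes effect because [x] does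
    not occur in [xs]. *)
Lemma upd_rcons T (r : nat -> T) xs x cs c : size cs = size xs ->
  x \notin xs ->
  upd r (rcons xs x) (rcons cs c) = upd (upd r xs cs) [:: x] [:: c].
Proof.
move=> sc xn; apply: funext => z.
rewrite /upd /= -[rcons xs x]cats1 index_cat nth_rcons sc.
have [zin|zn] := boolP (z \in xs).
  rewrite index_mem zin; case: eqP => [xz|_] /=.
    by rewrite -xz (negbTE xn) in zin *.
  by apply: set_nth_default; rewrite sc index_mem.
rewrite ltnNge leq_addr /= [x == z]eq_sym; case: (z == x) => /=.
  by rewrite addn0 eqxx.
by rewrite addn1 -[_.+1 == _]negbK neq_ltn ltnSn orbT nth_default // sc memNindex.
Qed.

Lemma valid_A11 (xs xsx : varlist) x A B : vars xsx = rcons xs x ->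
  x \notin fv A -> valid (All xsx B A) (All xs (Ex x B) A).
Proof.
move=> xsxE xA; have xn : x \notin vars xs.
  by have := vars_uniq xsx; rewrite xsxE rcons_uniq => /andP[].
have sz : size xsx = (size xs).+1 by rewrite xsxE size_rcons.
(* The given realizer takes one more variable: slot [size xs] receives the witness [p1 t] of the
   argument [t], and [p2 t] comes last. *)
have F := fam_app (n := (size xs).+1)
  (Phi := fun i _ y v => v = if i < size xs then nth 0 y i
                             else p1 P (nth 0 y (size xs)))
  (fam_index (D := fun x => Vidx U (size xsx).+1 (nth 0 x 0))
     arg_computable (fun x Dx => Dx)) _ (fam_p2_last _ _ (ltn0Sn 0)).
apply: (valid_All (N := 0) (F _)) => [i ix|M f rho s /rz_All[Is Hs]].
  apply: fam_fun => //; case ixs: (i < size xs).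
    by apply: proj_computable; rewrite ltnW.
  exact/computable_p1/proj_computable.
split=> // t c sc /rz_Ex[d dE dB].
have [||b eb rb] := Hs (p2 P t) (rcons c d).
- by rewrite size_rcons sc sz.
- by rewrite xsxE upd_rcons.
exists b; last by move: rb; rewrite xsxE upd_rcons // rz_fresh1.
exists (map val (rcons c d)), (p2 P t); split=> //.
- by rewrite size_map size_rcons sc sz.
- move=> i; rewrite sz ltnS => ix; rewrite map_rcons !nth_rcons size_map sc.
  rewrite ltnn eqxx; case: ltnP => // xi.
  by rewrite eqn_leq ix xi.
- by rewrite nth_size_rcons ?size_map.
Qed.

(** * The rules *)

Lemma valid_R1 A B C : valid A B -> valid B C -> valid A C.
Proof.
move=> vAB vBC; have [N [[e1 I1 E1] [e2 I2 E2]]] := valid_at2 vAB vBC.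
apply: (valid_fun (fam_app_last (ltn0Sn 0)
  (fam_const _ (ltn0Sn 0) I2) (fam_const _ (ltn0Sn 0) I1))).
move=> M f rho s /E1[b eb /E2[c ec rc]]; exists c => //; exists b => //.
by rewrite take_rcons ?size_mkseq.
Qed.

Lemma valid_R2 A B C : valid A B -> valid A C -> valid A (And B C).
Proof.
move=> vAB vBC; have [N [[e1 I1 E1] [e2 I2 E2]]] := valid_at2 vAB vBC.
apply: (valid_fun (fam_pair (ltn0Sn 0)
  (fam_const _ (ltn0Sn 0) I1) (fam_const _ (ltn0Sn 0) I2))).
move=> M f rho s As; have [b eb rb] := E1 M f rho s As.
have [c ec rc] := E2 M f rho s As.
exists (cpair P b c); first by exists b, c.
by rewrite /rz /= p1_cpair p2_cpair.
Qed.

Lemma valid_R3l A B C : valid A (And B C) -> valid A B.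
Proof.
move=> [N [e Ie eE]].
apply: (valid_fun (fam_p1 (ltn0Sn 0) (fam_const _ (ltn0Sn 0) Ie))).
by move=> M f rho s /eE[b eb [rb _]]; exists (p1 P b) => //; exists b.
Qed.

Lemma valid_R3r A B C : valid A (And B C) -> valid A C.
Proof.
move=> [N [e Ie eE]].
apply: (valid_fun (fam_p2 (ltn0Sn 0) (fam_const _ (ltn0Sn 0) Ie))).
by move=> M f rho s /eE[b eb [_ rb]]; exists (p2 P b) => //; exists b.
Qed.

Lemma valid_R4 A B C : valid B A -> valid C A -> valid (Or B C) A.
Proof.
move=> vB vC; have [N [[e1 I1 E1] [e2 I2 E2]]] := valid_at2 vB vC.
apply: (valid_fun (fam_cases
  (fam_app_last (ltn0Sn 0) (fam_const _ (ltn0Sn 0) I1)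
    (fam_p2_last _ _ (ltn0Sn 0)))
  (fam_app_last (ltn0Sn 0) (fam_const _ (ltn0Sn 0) I2)
    (fam_p2_last _ _ (ltn0Sn 0))))).
move=> M f rho s; rewrite nth_last_args take_rcons ?size_mkseq //.
by move=> [[-> /E1[b eb rb]]|[-> /E2[b eb rb]]]; exists b => //=; exists (p2 P s).
Qed.

(** R5 and R8 both run the premise on a pair of a head and the given realizer; the head is the tag 0
    or 1 in R5 and the value of [x] in R8. *)
Lemma valid_pair N G A B C : valid_at N B C -> computable N.+1 G ->
  (forall (M : set nat) (f : evaluation M) rho s, rz f rho A s ->
    rz f rho B (cpair P (G (rcons (mkseq (fun j => val (rho j)) N) s)) s)) ->
  valid A C.
Proof.
move=> [e Ie eE] cG H.
apply: (valid_fun (fam_app_last (ltn0Sn 0) (fam_const _ (ltn0Sn 0) Ie)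
  (fam_fun _ (ltn0Sn 0) (computable_pair cG (proj_computable (ltnSn N)))))).
move=> M f rho s /H/eE[b eb rb]; exists b => //.
by eexists; [reflexivity|rewrite nth_last_args take_rcons ?size_mkseq].
Qed.

Lemma valid_R5l A B C : valid (Or B C) A -> valid B A.
Proof.
move=> [N v]; apply: (valid_pair v (const_computable 0 (ltn0Sn N))).
by move=> M f rho s Bs; left; rewrite p1_cpair p2_cpair.
Qed.

Lemma valid_R5r A B C : valid (Or B C) A -> valid C A.
Proof.
move=> [N v]; apply: (valid_pair v (const_computable 1 (ltn0Sn N))).
by move=> M f rho s Bs; right; rewrite p1_cpair p2_cpair.
Qed.

Lemma valid_R8 x A B : x \notin fv A -> valid (Ex x B) A -> valid B A.
Proof.
(* [N] is raised above [x] so that [rho x], the witness, is among the arguments. *)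
move=> xA [N0 v0]; pose N := maxn N0 x.+1.
have v : valid_at N (Ex x B) A := valid_at_le (leq_maxl _ _) v0.
have xN : x < N := leq_maxr _ _.
apply: (valid_pair v (proj_computable (leqW xN))) => M f rho s Bs.
rewrite nth_args //; apply/rz_Ex; exists (rho x); first by rewrite p1_cpair.
rewrite p2_cpair; apply: (iffLR (rz_ext _ _ _) Bs) => y _.
by rewrite /upd /=; case: eqP => [->|].
Qed.

Lemma valid_R7 x A B : x \notin fv A -> valid B A -> valid (Ex x B) A.
Proof.
move=> xA [N [e Ie eE]].
(* The witness overwrites the argument for [x]; since [x] is not free in [A], the result also serves
   the original assignment. *)
have F := fam_app (n := N.+1)
  (Phi := fun i _ y v => v = if i == x then p1 P (nth 0 y N) else nth 0 y i)
  (fam_const (fun=> True) (ltn0Sn 0) Ie) _ (fam_p2_last _ _ (ltn0Sn 0)).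
apply: (valid_fun (F _)) => [i iN|M f rho s /rz_Ex[c cE /eE[b eb rb]]].
  apply: fam_fun => //; case: (i == x); last by apply/proj_computable/leqW.
  exact/computable_p1/proj_computable.
exists b; last exact: (iffLR (rz_fresh1 _ _ _ _ xA) rb).
do 2!eexists; split; last exact: eb.
- by rewrite size_mkseq.
- move=> i iN; rewrite nth_mkseq // nth_last_args nth_args // /upd /= eq_sym.
  by case: eqP.
- by rewrite nth_last_args.
Qed.

(** Currying: the assignment and the realizer [s] of [A] are frozen through [fam_upd] and
    [fam_param]. Freshness keeps [s] a realizer of [A] after [xs] is rebound. *)
Lemma valid_R9 (xs : varlist) A B C :
  (forall x, x \in vars xs -> x \notin fv A) ->
  valid (And A B) C -> valid A (All xs B C).
Proof.
move=> fresh [N [e Ie eE]].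
have F := fam_app (fam_const (fun=> True) (ltn0Sn N) Ie)
  (fun i iN => fam_upd _ (erefl (size xs)) iN)
  (fam_pair (ltn0Sn N) (fam_param _ (ltn0Sn N) (ltn0Sn (size xs))
     (proj_computable (ltnSn N))) (fam_last _ _ (ltn0Sn N))).
apply: (valid_All F) => M f rho s /= As; split=> // t c sc Bt.
have [|b eb rb] := eE M f (upd rho xs c) (cpair P s t).
  by split; rewrite ?p1_cpair ?p2_cpair //; apply/rz_fresh.
exists b => //; do 2!eexists; split; last exact: eb.
- by rewrite size_mkseq.
- move=> i iN; rewrite nth_mkseq // take_rcons ?size_map // (map_upd val).
  by apply: updE; rewrite ?size_map // nth_args.
- by exists s, t; rewrite nth_last_args nth_size_rcons ?size_map.
Qed.

Lemma valid_R6 (xs ys : varlist) A B A' B' : size ys = size xs ->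
  var_subst ys xs A A' -> var_subst ys xs B B' -> valid A B -> valid A' B'.
Proof.
(* [w i] is the variable put for [i], so the premise's argument [i] is read off at position [w i];
   [N'] strictly bounds these positions. *)
move=> sy sA sB [N [e Ie eE]]; pose w := upd id xs ys.
pose N' := \max_(j < N) (w j).+1.
have wN j : j < N -> w j < N'.+1.
  move=> jN; rewrite ltnS ltnW //.
  exact: (leq_bigmax (F := fun j : 'I_N => (w j).+1) (Ordinal jN)).
have F := fam_app (fam_const (fun=> True) (ltn0Sn 0) Ie)
  (fun i iN => fam_proj _ (ltn0Sn 0) (wN i iN)) (fam_last _ _ (ltn0Sn 0)).
apply: (valid_fun F) => M f rho s.
rewrite (rz_subst _ _ _ sA) => /eE[b eb rb]; exists b; last exact/(rz_subst _ _ _ sB).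
do 2!eexists; split; last exact: eb.
- by rewrite size_mkseq.
- move=> i iN; rewrite nth_mkseq // nth_args; last first.
    exact: (leq_bigmax (F := fun j : 'I_N => (w j).+1) (Ordinal iN)).
  by rewrite -(map_upd rho).
- by rewrite nth_last_args.
Qed.

(** * Soundness, and realizers for an admissible list *)

Lemma derivable_valid S : derivable S -> valid (ante S) (succ S).
Proof.
elim=> {S} /=.
- exact: valid_A1.
- exact: valid_A2.
- exact: valid_A3.
- exact: valid_A4.
- exact: valid_A5.
- exact: valid_A6.
- exact: valid_A7.
- exact: valid_A8.
- exact: valid_A9.
- exact: valid_A10.
- exact: valid_A11.
- by move=> A B C _ vAB _; apply: valid_R1.
- by move=> A B C _ vAB _; apply: valid_R2.
- by move=> A B C _; apply: valid_R3l.
- by move=> A B C _; apply: valid_R3r.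
- by move=> A B C _ vBA _; apply: valid_R4.
- by move=> A B C _; apply: valid_R5l.
- by move=> A B C _; apply: valid_R5r.
- by move=> xs ys A B A' B' sy sA sB _; apply: valid_R6 sA sB.
- by move=> x A B xA _; apply: valid_R7.
- by move=> x A B xA _; apply: valid_R8 xA.
- by move=> xs A B C fresh _; apply: valid_R9.
Qed.

Lemma valid_realizes (r : varlist) S : valid (ante S) (succ S) ->
  admissible r S -> 0 < size r ->
  exists e, forall (M : set nat) (f : evaluation M), realizes_sequent P U f r S e.
Proof.
move=> [N [e Ie eE]] adm r0.
(* Variables outside [r] are sent to position 0, which exists by [r0]; by admissibility none of them
   is free in [S]. *)
pose k j := if j \in vars r then index j r else 0.
have kr j : k j < size r by rewrite /k; case: ifP => //; rewrite index_mem.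
have [|d Id dE] := fam_app (n := (size r).+1)
  (Phi := fun j _ y v => v = nth 0 y (k j))
  (fam_const (fun=> True) (ltn0Sn 0) Ie) _ (fam_last _ _ (ltn0Sn 0)).
  by move=> j jN; apply: fam_proj => //; apply/leqW/kr.
have [//|m [_ Im mE]] := dE [:: 0] _ I.
exists m => M f; split=> // s a.
pose rho j := tnth a (Ordinal (kr j)).
have rhoE j : val (rho j) = nth 0 (map val a) (k j).
  rewrite (nth_map (rho j)) ?size_tuple ?kr //; congr val; exact: tnth_nth.
(* On variables in [r] the partial assignment binding only [r] agrees with the total [rho], so
   [realizes_ext] passes between the two. *)
have E A : {subset fv A <= vars r} ->
    {in fv (embed M A), upd (fun=> None) r [seq Some c | c <- a] =1
      (fun x => Some (rho x))}.
  move=> sub x; rewrite fv_fmap => /sub xr.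
  rewrite /upd (nth_map (rho x)) ?size_tuple ?index_mem //; congr Some.
  by rewrite [RHS](tnth_nth (rho x)) /= /k xr.
have [EA EB] : {subset fv (ante S) <= vars r} /\ {subset fv (succ S) <= vars r}.
  by split=> x xS; apply: (adm x); rewrite mem_cat xS ?orbT.
have {}EA := E _ EA; have {}EB := E _ EB.
move=> r' /(realizes_ext _ _ _ _ EA) As.
have [b eb rb] := eE M f rho s As.
exists b; last exact/(realizes_ext _ _ _ _ EB).
rewrite phi_ev; apply: mE; first by rewrite size_tuple.
do 2!eexists; split; last exact: eb.
- by rewrite size_mkseq.
- move=> j jN; rewrite nth_mkseq // rhoE /= nth_rcons size_map size_tuple.
  by rewrite kr.
- by rewrite /= nth_size_rcons // size_map size_tuple.
Qed.

End Families.

Theorem theorem3p1 (P : pairing) (U : vsystem)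
  (hBF : condBF P U) (hCm : condCm U) (hCn : condCn U) (hCs : condCs P U)
  (S : sequent) (r : varlist) :
  derivable S -> admissible r S -> (0 < size r)%N ->
  exists e : nat, forall (M : set nat) (f : evaluation M),
    realizes_sequent P U f r S e.
Proof.
move=> /(derivable_valid hBF hCm hCn hCs).
exact: valid_realizes hBF hCm hCn r S.
Qed.
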